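(* Let $\Lambda$ be a commutative domain. Then for every $\Lambda$-module $A$ the injective torsion $\mathfrak{s}(A)$, viewed as a submodule of $A$, coincides with the classical torsion submodule $\{a\in A : ra=0 \text{ for some } 0\neq r\in\Lambda\}$ of $A$.
   Context: For a ring $\Lambda$, let $\iota:\Lambda\to I$ be the injective envelope of $\Lambda$ viewed as a left $\Lambda$-module. For a right $\Lambda$-module $A$, the injective torsion of $A$ is $\mathfrak{s}(A):=\ker\big(1\otimes\iota: A\otimes_\Lambda\Lambda\to A\otimes_\Lambda I\big)$, identified with a submodule of $A$ via the canonical isomorphism $A\otimes_\Lambda\Lambda\cong A$. *)

(* Defs.v *)
From HB Require Import structures.
From mathcomp Require Import all_boot all_order all_algebra.
From mathcomp Require Import boolp classical_sets.
From mathcomp.multinomials Require Import freeg.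
Set Implicit Arguments.
Unset Strict Implicit.
Unset Printing Implicit Defensive.
Import GRing.Theory.
Local Open Scope quotient_scope.
Local Open Scope ring_scope.

(* Left R-modules are [lmodType R]; right R-modules are left modules over the
   converse ring, [lmodType R^c], so that a . r is [(r : R^c) *: a]. *)

Section TensorProduct.
Variables (R : pzRingType) (A : lmodType R^c) (M : lmodType R).

Local Notation F := {freeg (A * M)%type}.
Local Notation gen a m := (<< (a, m) >> : F).

Inductive tensor_relator : F -> Prop :=
| TensorDl a a' m : tensor_relator (gen (a + a') m - gen a m - gen a' m)
| TensorDr a m m' : tensor_relator (gen a (m + m') - gen a m - gen a m')
| TensorZ (r : R) a m :
    tensor_relator (gen ((r : R^c) *: a) m - gen a (r *: m)).

Definition tensor_relations : {pred F} := fun x : F =>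
  `[< forall S : zmodClosed F,
        (forall y, tensor_relator y -> y \in S) -> x \in S >].

Fact tensor_relations_closed : zmod_closed tensor_relations.
Proof.
split=> [|x y /asboolP hx /asboolP hy]; apply/asboolP => S hS.
  exact: rpred0.
by rewrite rpredB ?hx ?hy.
Qed.
HB.instance Definition _ :=
  GRing.isZmodClosed.Build F tensor_relations tensor_relations_closed.

Definition tensor : Type := {ideal_quot tensor_relations}.
HB.instance Definition _ := GRing.Zmodule.on tensor.

Definition tensor_pi (x : F) : tensor := \pi_{ideal_quot tensor_relations} x.
Definition tensor_repr (t : tensor) : F := repr (t : {ideal_quot tensor_relations}).

Definition tmul (a : A) (m : M) : tensor := tensor_pi (gen a m).

Lemma tensor_reprK : cancel tensor_repr tensor_pi.
Proof. exact: reprK. Qed.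

Lemma tensor_piD : {morph tensor_pi : x y / x + y}.
Proof. by move=> x y; rewrite /tensor_pi !piE. Qed.

Lemma tensor_piN : {morph tensor_pi : x / - x}.
Proof. by move=> x; rewrite /tensor_pi !piE. Qed.

Lemma tensor_piP x y : (tensor_pi x = tensor_pi y) <-> x - y \in tensor_relations.
Proof. by rewrite Quotient.idealrBE; split=> /eqP. Qed.

Lemma tensor_relatorW x : tensor_relator x -> x \in tensor_relations.
Proof. by move=> hx; apply/asboolP => S; apply. Qed.

Lemma tmulDl a a' m : tmul (a + a') m = tmul a m + tmul a' m.
Proof.
rewrite -tensor_piD; apply/tensor_piP; rewrite opprD addrA.
exact/tensor_relatorW/TensorDl.
Qed.

Lemma tmulDr a m m' : tmul a (m + m') = tmul a m + tmul a m'.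
Proof.
rewrite -tensor_piD; apply/tensor_piP; rewrite opprD addrA.
exact/tensor_relatorW/TensorDr.
Qed.

Lemma tmulZ (r : R) a m : tmul ((r : R^c) *: a) m = tmul a (r *: m).
Proof. exact/tensor_piP/tensor_relatorW/TensorZ. Qed.

Definition balanced (G : zmodType) (f : A -> M -> G) : Prop :=
  [/\ forall a a' m, f (a + a') m = f a m + f a' m,
      forall a m m', f a (m + m') = f a m + f a m' &
      forall (r : R) a m, f ((r : R^c) *: a) m = f a (r *: m)].

(* Independent of the chosen representatives only when [f] is balanced. *)
Definition tensor_lift (G : zmodType) (f : A -> M -> G) (t : tensor) : G :=
  fglift (fun p : A * M => f p.1 p.2 : zmodule G) (tensor_repr t).

Section Lift.
Variables (G : zmodType) (f : A -> M -> G).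
Hypothesis fB : balanced f.
Let flift : F -> zmodule G := fglift (fun p : A * M => f p.1 p.2 : zmodule G).

Let fliftB : {morph flift : x y / x - y}.
Proof. exact: lift_is_additive. Qed.

Let fliftU a m : flift (gen a m) = f a m.
Proof. by rewrite /flift liftU scale1r. Qed.

Let ker : {pred F} := fun x => flift x == 0.

Let ker_closed : zmod_closed ker.
Proof.
split=> [|x y]; rewrite !unfold_in /ker; first by rewrite -(subrr 0) fliftB subrr.
by move=> /eqP hx /eqP hy; rewrite fliftB hx hy subrr.
Qed.

Lemma tensor_lift_pi x : tensor_lift f (tensor_pi x) = flift x.
Proof.
pose k := GRing.isZmodClosed.Build F ker ker_closed.
pose K : zmodClosed F := HB.pack ker k.
have /asboolP/(_ K) h : tensor_repr (tensor_pi x) - x \in tensor_relations.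
  by apply/tensor_piP; rewrite tensor_reprK.
have {h} /eqP : tensor_repr (tensor_pi x) - x \in K.
  case: fB => fDl fDr fZ; apply: h => y [a a' m|a m m'|r a m]; apply/eqP.
  - by rewrite !fliftB !fliftU fDl addrAC addrK subrr.
  - by rewrite !fliftB !fliftU fDr addrAC addrK subrr.
  - by rewrite !fliftB !fliftU fZ subrr.
by rewrite fliftB => /eqP; rewrite subr_eq0 => /eqP.
Qed.

Lemma tensor_liftE a m : tensor_lift f (tmul a m) = f a m.
Proof. by rewrite tensor_lift_pi fliftU. Qed.

Lemma tensor_liftB : {morph tensor_lift f : t u / t - u}.
Proof.
move=> t u; rewrite -[t]tensor_reprK -[u]tensor_reprK -tensor_piN -tensor_piD.
by rewrite !tensor_lift_pi fliftB.
Qed.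
End Lift.

Lemma tensor_ind (P : tensor -> Prop) :
    (forall a m, P (tmul a m)) -> (forall t u, P t -> P u -> P (t - u)) ->
  forall t, P t.
Proof.
move=> Pgen PB.
have P0 : P 0 by rewrite -(subrr (tmul 0 0)); apply: PB.
have PN t : P t -> P (- t) by move=> Pt; rewrite -sub0r; apply: PB.
have PD t u : P t -> P u -> P (t + u).
  by move=> Pt Pu; rewrite -[u]opprK; apply/PB => //; apply: PN.
move=> t; rewrite -[t]tensor_reprK.
have pi0 : tensor_pi 0 = 0 by rewrite -(subrr 0) tensor_piD tensor_piN subrr.
rewrite -(freeg_sumE (tensor_repr t)); elim/big_ind: _ => [|x y Px Py|[a m] _].
- by rewrite pi0.
- by rewrite tensor_piD; apply: PD.
have -> : << coeff (a, m) (tensor_repr t) *g (a, m) >>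
          = gen a m *~ coeff (a, m) (tensor_repr t).
  by rewrite freegU_mulz intz.
have Pn n : P (tensor_pi (gen a m *+ n)).
  elim: n => [|n IHn]; first by rewrite mulr0n pi0.
  by rewrite mulrS tensor_piD; apply: PD => //; apply: Pgen.
case: (coeff _ _) => n; first exact: Pn.
by rewrite NegzE mulrNz tensor_piN; apply/PN/Pn.
Qed.
End TensorProduct.

(* The homomorphism 1 (x) f : A (x) M -> A (x) N. *)
Definition tensor_map (R : pzRingType) (A : lmodType R^c) (M N : lmodType R)
    (f : {linear M -> N}) : tensor A M -> tensor A N :=
  tensor_lift (fun a m => tmul a (f m)).

(* The canonical isomorphism A (x) R -> A, a (x) r |-> a . r. *)
Definition tensor_unit (R : pzRingType) (A : lmodType R^c) : tensor A R^o -> A :=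
  tensor_lift (fun a (r : R^o) => (r : R^c) *: a).

Section TensorMaps.
Variables (R : pzRingType) (A : lmodType R^c) (M N : lmodType R).
Variable f : {linear M -> N}.

Let map_balanced : balanced (fun (a : A) (m : M) => tmul a (f m)).
Proof.
split=> [a a' m|a m m'|r a m]; first exact: tmulDl.
- by rewrite linearD tmulDr.
- by rewrite linearZ tmulZ.
Qed.

Lemma tensor_mapE (a : A) m : tensor_map f (tmul a m) = tmul a (f m).
Proof. exact: (tensor_liftE map_balanced). Qed.

Lemma tensor_mapB : {morph @tensor_map R A M N f : t u / t - u}.
Proof. exact: (tensor_liftB map_balanced). Qed.

Let unit_balanced : balanced (fun (a : A) (r : R^o) => (r : R^c) *: a).
Proof.
split=> [a a' r|a r r'|s a r]; rewrite ?scalerDr ?scalerDl //.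
by rewrite scalerA.
Qed.

Lemma tensor_unitE (a : A) (r : R^o) :
  tensor_unit (tmul a r) = (r : R^c) *: a.
Proof. exact: (tensor_liftE unit_balanced). Qed.

Lemma tensor_unitB : {morph @tensor_unit R A : t u / t - u}.
Proof. exact: (tensor_liftB unit_balanced). Qed.

Lemma tensor_unitK : cancel (@tensor_unit R A) (fun a => tmul a (1 : R^o)).
Proof.
elim/tensor_ind => [a r|t u IHt IHu].
  by rewrite tensor_unitE tmulZ [_ *: _]mulr1.
rewrite tensor_unitB -[in RHS]IHt -[in RHS]IHu.
by apply/eqP; rewrite eq_sym subr_eq -tmulDl subrK.
Qed.

Lemma tensor_unitVK : cancel (fun a => tmul a (1 : R^o)) (@tensor_unit R A).
Proof. by move=> a; rewrite tensor_unitE [LHS]scale1r. Qed.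

Lemma tensor_unit_bij : bijective (@tensor_unit R A).
Proof. exact: Bijective tensor_unitK tensor_unitVK. Qed.
End TensorMaps.

Section InjectiveEnvelope.
Variable R : pzRingType.

Definition injective_module (E : lmodType R) : Prop :=
  forall (X Y : lmodType R) (f : {linear X -> Y}) (g : {linear X -> E}),
    injective f -> exists h : {linear Y -> E}, forall x, h (f x) = g x.

Definition essential_mono (M E : lmodType R) (f : {linear M -> E}) : Prop :=
  injective f /\
  forall S : submodClosed E,
    (exists2 x, x \in S & x != 0) ->
    exists m, f m \in S /\ f m != 0.

Definition injective_envelope (M E : lmodType R) (f : {linear M -> E}) : Prop :=
  injective_module E /\ essential_mono f.
End InjectiveEnvelope.

(* The kernel of 1 (x) iota, transported to A along the canonical isomorphism. *)
Definition injective_torsion (R : pzRingType) (I : lmodType R)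
    (iota : {linear R^o -> I}) (A : lmodType R^c) : set A :=
  (@tensor_unit R A @` [set t | tensor_map iota t = 0])%classic.
Arguments injective_torsion {R I} iota A _.

Lemma injective_torsionP (R : pzRingType) (I : lmodType R)
    (iota : {linear R^o -> I}) (A : lmodType R^c) (a : A) :
  injective_torsion iota A a <-> tmul a (iota 1) = 0 :> tensor A I.
Proof.
split=> [[t /= ht <-]|ha].
  by rewrite -[RHS]ht -[in RHS](tensor_unitK t) tensor_mapE.
by exists (tmul a (1 : R^o)); rewrite /= ?tensor_mapE ?tensor_unitVK.
Qed.

(* A module over a commutative ring, viewed as a right module: a . r = r a. *)
Definition rightmod (R : comPzRingType) (A : lmodType R) : Type := A.

Section RightMod.
Variables (R : comPzRingType) (A : lmodType R).
HB.instance Definition _ := GRing.Zmodule.on (rightmod A).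

Let rscale (r : R^c) (a : rightmod A) : rightmod A := (r : R) *: (a : A).

Fact rscaleA r s a : rscale r (rscale s a) = rscale (r * s) a.
Proof. by rewrite /rscale scalerA mulrC. Qed.
Fact rscale1 : left_id 1 rscale.
Proof. exact: scale1r. Qed.
Fact rscaleDr : right_distributive rscale +%R.
Proof. by move=> r a b; exact: (@scalerDr R A). Qed.
Fact rscaleDl a : {morph rscale^~ a : r s / r + s}.
Proof. by move=> r s; exact: (@scalerDl R A). Qed.

HB.instance Definition _ := GRing.Zmodule_isLmodule.Build R^c (rightmod A)
  rscaleA rscale1 rscaleDr rscaleDl.
Lemma rightmodE (r : R) (a : A) :
  (r : R^c) *: (a : rightmod A) = (r *: a : A).
Proof. by []. Qed.
End RightMod.

Definition classical_torsion (R : pzRingType) (A : lmodType R) : set A :=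
  [set a | exists2 r : R, r != 0 & r *: a = 0]%classic.
Arguments classical_torsion {R} A _.

(* Main.v *)
Require Import Defs.
From HB Require Import structures.
From mathcomp Require Import all_boot all_order all_algebra.
From mathcomp Require Import boolp classical_sets.
Set Implicit Arguments.
Unset Strict Implicit.
Unset Printing Implicit Defensive.
Import GRing.Theory.
Local Open Scope ring_scope.

(** If [r a = 0] with [r != 0], write [iota 1 = r y] by divisibility of the
    injective module [I]; then [a (x) iota 1 = r a (x) y = 0].
    Conversely, essentiality makes [I] torsion-free of rank one, so each [m] in
    [I] is the value at [iota 1] of a unique endomorphism [h m] of [I].  If [a]
    is not torsion, injectivity of [I] yields [g : A -> I] with
    [g a = iota 1], and [(x, m) |-> h m (g x)] is a balanced map sending
    [(a, iota 1)] to [iota 1 != 0]. *)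

Section ScalarLine.
Variables (R : pzRingType) (M : lmodType R) (x : M).

Definition scalar_line (r : R^o) : M := (r : R) *: x.

Fact scalar_line_linear : linear scalar_line.
Proof. by move=> r s t; rewrite /scalar_line scalerDl -scalerA. Qed.
HB.instance Definition _ :=
  GRing.isLinear.Build R R^o M *:%R scalar_line scalar_line_linear.

Definition line : {pred M} := fun v => `[< exists r : R, v = r *: x >].

Fact line_submod_closed : submod_closed line.
Proof.
split=> [|r u v /asboolP[s ->] /asboolP[t ->]]; apply/asboolP.
  by exists 0; rewrite scale0r.
by exists (r * s + t); rewrite scalerDl scalerA.
Qed.
HB.instance Definition _ := GRing.isSubmodClosed.Build R M line line_submod_closed.

Lemma lineP v : reflect (exists r : R, v = r *: x) (v \in line).
Proof. exact: asboolP. Qed.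
End ScalarLine.

(** Essentiality is tested on the cyclic submodule [line x], nonzero because it contains [x]. *)
Lemma essential_mono_scale (R : pzRingType) (M E : lmodType R)
    (f : {linear M -> E}) (x : E) :
  essential_mono f -> x != 0 -> exists m r, f m = r *: x /\ f m != 0.
Proof.
move=> [_ fess] x0; have [|m [/lineP[r fm] fm0]] := fess (line x).
  by exists x => //; apply/lineP; exists 1; rewrite scale1r.
by exists m, r.
Qed.

Lemma scalar_line_inj (R : pzRingType) (M : lmodType R) (x : M) :
  ~ classical_torsion M x -> injective (scalar_line x).
Proof.
move=> xNtors r s rs; apply/eqP; rewrite -subr_eq0; apply: contra_notT xNtors.
move=> rs0; exists (r - s) => //; rewrite scalerBl; apply/eqP.
by rewrite subr_eq0; apply/eqP.
Qed.

(** As [x] is not torsion, [r |-> r x] embeds [R] in [M]; extend [r |-> r e] along it and evaluate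
    at 1. *)
Lemma injective_extend_at (R : pzRingType) (E M : lmodType R) (x : M) (e : E) :
    injective_module E -> ~ classical_torsion M x ->
  exists h : {linear M -> E}, h x = e.
Proof.
move=> Einj /scalar_line_inj xinj.
have [h hE] := Einj _ _ (scalar_line x) (scalar_line e) xinj.
by exists h; rewrite -[x]scale1r -[RHS]scale1r; apply: (hE 1).
Qed.

Lemma injective_divisible (R : idomainType) (E : lmodType R) (r : R) (e : E) :
  injective_module E -> r != 0 -> exists y, e = r *: y.
Proof.
(* In a domain [r] is not torsion in [R^o], and [e = h r = r (h 1)]. *)
move=> Einj r0; have [|h hE] := @injective_extend_at R E R^o r e Einj.
  move=> [s s0 /eqP]; rewrite [_ *: _]/(s * r) mulf_eq0.
  by rewrite (negPf s0) (negPf r0).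
by exists (h 1); rewrite -linearZ [_ *: _]mulr1.
Qed.

Section EssentialExtension.
Variables (R : idomainType) (I : lmodType R) (iota : {linear R^o -> I}).
Hypothesis iota_ess : essential_mono iota.

Lemma iota_scale (r : R) : iota r = r *: iota 1.
Proof. by rewrite -linearZ [_ *: _]mulr1. Qed.

(** If [x != 0], some [iota m = s x] is nonzero; but [r] kills it, so [r m = 0] and [m = 0] in the
    domain. *)
Lemma essential_torsion_free (x : I) : classical_torsion I x -> x = 0.
Proof.
move=> [r r0 rx]; apply: contrapT => /eqP x0.
have [m [s [fm]]] := essential_mono_scale iota_ess x0.
have : iota (r * m) = 0.
  by rewrite -[r * m]/(r *: (m : R^o)) linearZ /= fm scalerA mulrC -scalerA rx scaler0.
rewrite -[X in _ = X](linear0 iota) => /iota_ess.1/eqP.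
by rewrite mulf_eq0 (negPf r0) => /eqP ->; rewrite linear0 eqxx.
Qed.

(** A nonzero multiple [r x] lies in the image of [iota], where [f] and [g] agree; torsion-freeness
    cancels [r]. *)
Lemma essential_linear_eq (f g : {linear I -> I}) :
  f (iota 1) = g (iota 1) -> f =1 g.
Proof.
move=> fg x; have [->|x0] := eqVneq x 0; first by rewrite !linear0.
have [m [r [rx fm0]]] := essential_mono_scale iota_ess x0.
apply/eqP; rewrite -subr_eq0; apply/eqP/essential_torsion_free; exists r.
  by apply: contra_neq fm0 => r0; rewrite rx r0 scale0r.
by rewrite scalerBr -!linearZ -rx iota_scale 2!linearZZ fg subrr.
Qed.

Lemma iota1_neq0 : iota 1 != 0.
Proof.
by rewrite -(linear0 iota) (inj_eq iota_ess.1) oner_neq0.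
Qed.

Lemma envelope_endomorphisms : injective_module I ->
  exists h : I -> {linear I -> I}, forall m, h m (iota 1) = m.
Proof.
move=> Iinj; suff /choice[h hE] m : exists h : {linear I -> I}, h (iota 1) = m.
  by exists h.
apply: injective_extend_at => //.
by move/essential_torsion_free/eqP; apply/negP/iota1_neq0.
Qed.

End EssentialExtension.

Theorem proposition2p2 (Lambda : idomainType) (I : lmodType Lambda)
    (iota : {linear Lambda^o -> I}) (iota_env : injective_envelope iota)
    (A : lmodType Lambda) :
  injective_torsion iota (rightmod A) = classical_torsion A :> set A.
Proof.
have [Iinj Iess] := iota_env.
apply/funext => a; apply/propext; rewrite injective_torsionP; split; last first.
  move=> [r r0 ra]; have [y ->] := injective_divisible (iota 1) Iinj r0.
  rewrite -tmulZ rightmodE ra.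
  (* [0 (x) y] vanishes because it equals its own double. *)
  by apply: (addIr (tmul (0 : rightmod A) y)); rewrite -tmulDl !add0r.
move=> a0; apply: contrapT => aNtors.
have [g ga] := injective_extend_at (iota 1) Iinj aNtors.
have [h hE] := envelope_endomorphisms Iess Iinj.
pose f (x : rightmod A) (m : I) : I := h m (g x).
have fB : balanced f.
  split=> [x y m|x m n|r x m]; rewrite /f.
  - by rewrite -linearD -(linearD g).
  (* [h] comes from choice, so its linearity in [m] rests on uniqueness: both endomorphisms agree at
     [iota 1]. *)
  - rewrite (essential_linear_eq Iess (f := h (m + n)) (g := h m \+ h n)) //.
    by rewrite /= !hE.
  - rewrite rightmodE !linearZ.
    rewrite (essential_linear_eq Iess (f := h (r *: m)) (g := r \*: h m)) //.
    by rewrite /= !hE.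
have := tensor_liftE fB a (iota 1).
rewrite a0 -[X in tensor_lift f X](subrr 0) (tensor_liftB fB) subrr /f ga hE.
by move/esym/eqP; apply/negP/(iota1_neq0 Iess).
Qed.
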